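(* In the Rayleigh fading system model of the context with a single beam ($M=1$), if $\rho\le 1$ then the ergodic sum rate $R(\vec p)$ is a Schur-concave function of the feedback probabilities $\vec p\in[0,1]^n$. Consequently, a homogeneous threshold feedback policy solves the threshold selection problem: for every $\lambda\in(0,n]$ and every threshold vector $\vec\tau$ with $\sum_{i=1}^n \Pr\{\gamma_{i,1}\ge\tau_i\}\le\lambda$, there is a homogeneous threshold vector $\vec\tau'=(\tau,\dots,\tau)$ satisfying the same constraint with $R(\vec\tau')\ge R(\vec\tau)$.
   Context: System model: there are $n\ge 2$ users and $M\ge1$ beams. The SINR of user $i$ on beam $m$ is $\gamma_{i,m} = |X_{i,m}|^2 / \big(\tfrac1\rho + \sum_{k\ne m}|X_{i,k}|^2\big)$ with $\rho>0$, where (Rayleigh fading) the $X_{i,k}$ are i.i.d. unit-power circularly symmetric complex Gaussian; users are i.i.d., and the marginal distribution of each $\gamma_{i,m}$ is $F(x) = 1 - e^{-x/\rho}/(x+1)^{M-1}$, $x\ge0$, with density $f(x) = \frac{e^{-x/\rho}}{(x+1)^M}\big[\tfrac1\rho(x+1)+M-1\big]$. Each user $i$ has a threshold $\tau_i\in[0,\infty]$ and truncated SINR $\bar\gamma_{i,m}=\gamma_{i,m}\mathbf 1\{\gamma_{i,m}\ge\tau_i\}$. The ergodic sum rate is $R(\vec\tau) = \mathbb{E}\big[\sum_{m=1}^M\log(1+\max_{1\le i\le n}\bar\gamma_{i,m})\big]$. The feedback probability is $p_i = \Pr\{\gamma_{i,1}\ge\tau_i\}=1-F(\tau_i)$, and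 $R$ is regarded as a function $R(\vec p)$ via $\tau_i=F^{-1}(1-p_i)$ (with $F^{-1}(1)=+\infty$). A threshold vector is homogeneous if all thresholds are equal. Majorization: $\vec x$ majorizes $\vec y$ if the partial sums of the decreasingly ordered coordinates of $\vec x$ dominate those of $\vec y$ and the total sums are equal; $\varphi$ is Schur-concave if $\vec x$ majorizing $\vec y$ implies $\varphi(\vec x)\le\varphi(\vec y)$. *)

(* Defs.v *)
From Stdlib Require Import Reals Lra List Permutation Sorted Classical ClassicalEpsilon.
Open Scope R_scope.

Definition Fsinr (rho : R) (M : nat) (x : R) : R :=
  1 - exp (- x / rho) / (x + 1) ^ (M - 1).
Definition fsinr (rho : R) (M : nat) (x : R) : R :=
  exp (- x / rho) / (x + 1) ^ M * (/ rho * (x + 1) + INR (M - 1)).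

Definition is_int0inf (f : R -> R) (l : R) : Prop :=
  (forall b, 0 <= b -> exists _ : Riemann_integrable f 0 b, True) /\
  forall eps, 0 < eps -> exists B, forall b (pr : Riemann_integrable f 0 b),
      B <= b -> Rabs (RiemannInt pr - l) < eps.

Definition int0inf (f : R -> R) : R :=
  epsilon (inhabits 0) (fun l => is_int0inf f l).

(* Expectation of g(gamma_1,...,gamma_n) for n i.i.d. nonnegative random
   variables with density dens, as an iterated (Fubini/Tonelli) integral. *)
Fixpoint expect_iid (dens : R -> R) (n : nat) (g : list R -> R) : R :=
  match n with
  | O => g nil
  | S k => int0inf (fun x => dens x * expect_iid dens k (fun xs => g (x :: xs)))
  end.

(* Thresholds in [0, +oo]: None stands for +oo. *)
Definition valid_thr (t : option R) : Prop :=
  match t with None => True | Some x => 0 <= x end.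

Definition trunc (t : option R) (g : R) : R :=
  match t with
  | None => 0
  | Some x => if Rle_dec x g then g else 0
  end.

Definition maxR (l : list R) : R := fold_right Rmax 0 l.

Definition sumrate (rho : R) (tau : list (option R)) : R :=
  expect_iid (fsinr rho 1) (length tau)
    (fun gs => ln (1 + maxR (map (fun tg => trunc (fst tg) (snd tg)) (combine tau gs)))).

(* Feedback probability p = Pr{gamma >= tau} = 1 - F(tau), with F(+oo) = 1. *)
Definition fbprob (rho : R) (t : option R) : R :=
  match t with None => 0 | Some x => 1 - Fsinr rho 1 x end.

Definition sumR (l : list R) : R := fold_right Rplus 0 l.

Definition Finv (rho : R) (y : R) : option R :=
  if Req_EM_T y 1 then None
  else Some (epsilon (inhabits 0) (fun x => 0 <= x /\ Fsinr rho 1 x = y)).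

Definition sumrate_p (rho : R) (p : list R) : R :=
  sumrate rho (map (fun pi => Finv rho (1 - pi)) p).

Definition majorizes (x y : list R) : Prop :=
  length x = length y /\
  exists xs ys, Permutation x xs /\ Sorted Rge xs /\
                Permutation y ys /\ Sorted Rge ys /\
                (forall k, (k <= length x)%nat ->
                   sumR (firstn k ys) <= sumR (firstn k xs)) /\
                sumR xs = sumR ys.

Definition in01 (x : R) : Prop := 0 <= x <= 1.

(* Main.v *)
(* A truncated SINR exceeds [x >= 0] with probability [min(p_i, u)], [u = exp(-x/rho)].
   Writing [E ln(1 + max)] as an integral of tail probabilities, [R(p)] is the integral
   over [x >= 0] of [(1 - prod_i (1 - min(p_i, u))) / (1 + x)].
   Majorization reduces to transfers between two users, [(a, b)] to [(a', b')] with
   the same sum.  As a function of [u] in [0,1] the induced change of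
   [(1 - min(a, u)) (1 - min(b, u))] is first nonpositive, then nonnegative, and has
   nonpositive integral.  After the substitution, its weight is the product over the
   other users divided by [(1 + x) u]; when [rho <= 1] this decreases in [u], so the
   weighted integral is nonpositive as well and the transfer increases the rate. *)
From Coquelicot Require Import Coquelicot.
Require Import Defs.
From Stdlib Require Import Reals List Permutation Sorted Lra Lia
  ClassicalEpsilon FunctionalExtensionality.
Open Scope R_scope.

(** * Limits at infinity, improper integrals and continuity *)

Lemma is_lim_0_squeeze (f g : R -> R) (B : R) :
  (forall x, B < x -> Rabs (f x) <= g x) ->
  is_lim g p_infty 0 -> is_lim f p_infty 0.
Proof.
  intros H Hg. apply is_lim_spec. intros eps.
  apply is_lim_spec in Hg. destruct (Hg eps) as [M HM].
  exists (Rmax B M). intros x Hx.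
  pose proof (Rmax_l B M). pose proof (Rmax_r B M).
  specialize (H x ltac:(lra)). specialize (HM x ltac:(lra)).
  rewrite Rminus_0_r in *. pose proof (Rle_abs (g x)). lra.
Qed.

Lemma is_lim_incr_bounded (f : R -> R) (C : R) :
  (forall x y, 0 <= x <= y -> f x <= f y) ->
  (forall x, 0 <= x -> f x <= C) ->
  exists l : R, is_lim f p_infty l.
Proof.
  intros Hincr Hb.
  destruct (completeness (fun y => exists x, 0 <= x /\ y = f x)) as [l [Hub Hlub]].
  - exists C. intros y [x [Hx ->]]. auto.
  - exists (f 0), 0. lra.
  - exists l. apply is_lim_spec. intros eps.
    assert (exists x, 0 <= x /\ l - eps < f x) as [x0 [Hx0 Hl]].
    { apply NNPP. intros Hn. pose proof (cond_pos eps).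
      assert (l <= l - eps); [|lra].
      apply Hlub. intros y [x [Hx ->]].
      destruct (Rle_dec (f x) (l - eps)) as [h|h]; [exact h|].
      exfalso. apply Hn. exists x. lra. }
    exists x0. intros x Hx. simpl.
    pose proof (Hincr x0 x ltac:(lra)).
    assert (f x <= l) by (apply Hub; exists x; split; [lra|reflexivity]).
    rewrite Rabs_left1; lra.
Qed.

Lemma int0inf_unique (f : R -> R) (l1 l2 : R) :
  is_int0inf f l1 -> is_int0inf f l2 -> l1 = l2.
Proof.
  intros [Hi H1] [_ H2].
  apply cond_eq. intros eps Heps.
  destruct (H1 (eps / 2) ltac:(lra)) as [B1 HB1].
  destruct (H2 (eps / 2) ltac:(lra)) as [B2 HB2].
  set (b := Rmax 0 (Rmax B1 B2)).
  pose proof (Rmax_l 0 (Rmax B1 B2)). pose proof (Rmax_r 0 (Rmax B1 B2)).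
  pose proof (Rmax_l B1 B2). pose proof (Rmax_r B1 B2). fold b in H, H0.
  destruct (Hi b ltac:(lra)) as [pr _].
  specialize (HB1 b pr ltac:(lra)). specialize (HB2 b pr ltac:(lra)).
  apply Rabs_def2 in HB1. apply Rabs_def2 in HB2. apply Rabs_def1; lra.
Qed.

(** Replaces the value chosen by [epsilon] with a limit of explicit integrals. The formula [I] is
    required only from [s] on, because the integrands met later have another closed form below a
    threshold. *)
Lemma int0inf_eq (f : R -> R) (I : R -> R) (s l : R) :
  (forall b, 0 <= b -> ex_RInt f 0 b) ->
  (forall b, s <= b -> is_RInt f 0 b (I b)) ->
  is_lim I p_infty l -> int0inf f = l.
Proof.
  intros Hex HI Hlim.
  assert (is_int0inf f l) as Hl.
  { split.
    - intros b Hb. exists (ex_RInt_Reals_0 _ _ _ (Hex b Hb)). exact Logic.I.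
    - intros eps Heps. apply is_lim_spec in Hlim.
      destruct (Hlim (mkposreal eps Heps)) as [M HM].
      exists (Rmax s (M + 1)). intros b pr Hb.
      pose proof (Rmax_l s (M + 1)). pose proof (Rmax_r s (M + 1)).
      rewrite <- RInt_Reals, (is_RInt_unique _ _ _ _ (HI b ltac:(lra))).
      apply (HM b). lra. }
  apply (int0inf_unique f); [|exact Hl].
  unfold int0inf. apply epsilon_spec. exists l. exact Hl.
Qed.

Lemma continuous_Rmin (f g : R -> R) (x : R) :
  continuous f x -> continuous g x -> continuous (fun y => Rmin (f y) (g y)) x.
Proof.
  intros Hf Hg.
  apply (continuous_ext (fun y => / 2 * (f y + g y - Rabs (f y - g y)))).
  - intros y. unfold Rmin, Rabs. destruct Rle_dec, Rcase_abs; lra.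
  - apply (continuous_mult (K := R_AbsRing) (fun _ => / 2)); [apply continuous_const|].
    apply (continuous_minus (V := R_NormedModule)).
    + apply (continuous_plus (V := R_NormedModule)); assumption.
    + apply continuous_Rabs_comp.
      apply (continuous_minus (V := R_NormedModule)); assumption.
Qed.

Lemma continuous_Rmult (f g : R -> R) (x : R) :
  continuous f x -> continuous g x -> continuous (fun y => f y * g y) x.
Proof. apply (continuous_mult (K := R_AbsRing)). Qed.

Lemma continuous_Rminus (f g : R -> R) (x : R) :
  continuous f x -> continuous g x -> continuous (fun y => f y - g y) x.
Proof. apply (continuous_minus (V := R_NormedModule)). Qed.

Lemma continuous_ex_RInt (f : R -> R) (a b : R) :
  (forall x, continuous f x) -> ex_RInt f a b.
Proof. intros H. apply (ex_RInt_continuous (V := R_CompleteNormedModule)). auto. Qed.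

Lemma continuous_is_derive_RInt (f : R -> R) (a x : R) :
  (forall y, continuous f y) -> is_derive (RInt f a) x (f x).
Proof.
  intros H. apply is_derive_RInt with a; [|apply H].
  apply filter_forall. intros b. apply RInt_correct. apply continuous_ex_RInt. exact H.
Qed.

Lemma RInt_Rminus (f g : R -> R) (a b : R) :
  ex_RInt f a b -> ex_RInt g a b ->
  RInt (fun x => f x - g x) a b = RInt f a b - RInt g a b.
Proof. apply (RInt_minus (V := R_CompleteNormedModule)). Qed.

(** * The sum rate as a limit of one-dimensional integrals *)

Section Rate.

Variable rho : R.
Hypothesis rho_pos : 0 < rho.

Definition ccdf (x : R) : R := exp (- x / rho).

Fixpoint cdf_max (p : list R) (x : R) : R :=
  match p with
  | nil => 1
  | a :: p' => (1 - Rmin a (ccdf x)) * cdf_max p' x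
  end.

(* The absolute value makes the integrand continuous on the whole line. *)
Definition rate_dens (p : list R) (x : R) : R := / (1 + Rabs x) * cdf_max p x.

Definition cumul (p : list R) (b : R) : R := RInt (rate_dens p) 0 b.

(* [max_i trunc gamma_i] has distribution function [cdf_max p], hence
   [E ln (1 + max)] is the integral of [(1 - cdf_max p x) / (1 + x)]. *)
Definition rate (p : list R) : R :=
  real (Lim (fun b => ln (1 + b) - cumul p b) p_infty).

Lemma ccdf_pos x : 0 < ccdf x.
Proof. apply exp_pos. Qed.

Lemma ccdf_0 : ccdf 0 = 1.
Proof. unfold ccdf. replace (- 0 / rho) with 0 by (field; lra). apply exp_0. Qed.

Lemma ccdf_le x y : x <= y -> ccdf y <= ccdf x.
Proof.
  intros [H| ->]; [|lra]. left. unfold ccdf, Rdiv. apply exp_increasing.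
  pose proof (Rinv_0_lt_compat _ rho_pos). nra.
Qed.

Lemma ccdf_le1 x : 0 <= x -> ccdf x <= 1.
Proof. intros H. rewrite <- ccdf_0. apply ccdf_le, H. Qed.

Lemma is_derive_ccdf x : is_derive ccdf x (- (ccdf x / rho)).
Proof. unfold ccdf. auto_derive; [lra|]. unfold Rdiv. ring. Qed.

Lemma continuous_ccdf x : continuous ccdf x.
Proof. apply (ex_derive_continuous (V := R_NormedModule)). eexists. apply is_derive_ccdf. Qed.

Lemma is_lim_neg_div : is_lim (fun x => - x / rho) p_infty m_infty.
Proof.
  apply is_lim_ext with (fun x => (- / rho) * x); [intros; field; lra|].
  replace m_infty with (Rbar_mult (- / rho) p_infty).
  - apply is_lim_scal_l, is_lim_id.
  - simpl. pose proof (Rinv_0_lt_compat _ rho_pos).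
    destruct Rle_dec; [|reflexivity]. exfalso; lra.
Qed.

Lemma is_lim_ccdf : is_lim ccdf p_infty 0.
Proof.
  unfold ccdf.
  apply (is_lim_comp exp (fun x => - x / rho) p_infty 0 m_infty).
  - apply is_lim_exp_m.
  - apply is_lim_neg_div.
  - exists 0. discriminate.
Qed.

Lemma is_lim_id_ccdf : is_lim (fun x => (x + 1) * ccdf x) p_infty 0.
Proof.
  replace (Finite 0) with (Rbar_plus 0 0) by (simpl; f_equal; ring).
  apply is_lim_ext with (fun x => x * ccdf x + ccdf x); [intros; ring|].
  apply is_lim_plus'; [|apply is_lim_ccdf].
  apply is_lim_ext with (fun x => - rho * ((- x / rho) * exp (- x / rho))).
  { intros. unfold ccdf. field. lra. }
  replace (Finite 0) with (Rbar_mult (- rho) 0) by (simpl; f_equal; ring).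
  apply is_lim_scal_l.
  apply (is_lim_comp (fun y => y * exp y) (fun x => - x / rho) p_infty 0 m_infty).
  - apply is_lim_mul_exp_m.
  - apply is_lim_neg_div.
  - exists 0. discriminate.
Qed.

Lemma Rmin_ccdf_bounds a x : in01 a -> 0 <= Rmin a (ccdf x) <= 1.
Proof.
  intros [H0 H1]. pose proof (ccdf_pos x).
  unfold Rmin. destruct Rle_dec; lra.
Qed.

Lemma cdf_max_bounds p x : Forall in01 p -> 0 <= cdf_max p x <= 1.
Proof.
  induction 1 as [|a p Ha _ IH]; simpl; [lra|].
  pose proof (Rmin_ccdf_bounds a x Ha). nra.
Qed.

Lemma cdf_max_le p x y : Forall in01 p -> x <= y -> cdf_max p x <= cdf_max p y.
Proof.
  intros Hp Hxy. induction Hp as [|a p Ha Hp IH]; simpl; [lra|].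
  pose proof (Rmin_ccdf_bounds a x Ha). pose proof (Rmin_ccdf_bounds a y Ha).
  pose proof (cdf_max_bounds p x Hp). pose proof (ccdf_le x y Hxy).
  assert (Rmin a (ccdf y) <= Rmin a (ccdf x)).
  { unfold Rmin; repeat destruct Rle_dec; lra. }
  nra.
Qed.

Lemma cdf_max_perm p q x : Permutation p q -> cdf_max p x = cdf_max q x.
Proof. induction 1; simpl; nra. Qed.

Lemma continuous_cdf_max p x : continuous (cdf_max p) x.
Proof.
  induction p as [|a p IH]; simpl; [apply continuous_const|].
  apply continuous_Rmult; [|exact IH].
  apply continuous_Rminus; [apply continuous_const|].
  apply continuous_Rmin; [apply continuous_const|apply continuous_ccdf].
Qed.

Lemma continuous_rate_dens p x : continuous (rate_dens p) x.
Proof.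
  apply continuous_Rmult; [|apply continuous_cdf_max].
  apply (continuous_comp (fun x => 1 + Rabs x) Rinv).
  - apply (continuous_plus (V := R_NormedModule) (fun _ => 1) Rabs);
      [apply continuous_const|apply continuous_Rabs].
  - apply continuity_pt_filterlim. apply (continuity_pt_inv id).
    + apply derivable_continuous_pt, derivable_pt_id.
    + unfold id. pose proof (Rabs_pos x). lra.
Qed.

Lemma rate_dens_bounds p x : Forall in01 p -> 0 <= rate_dens p x <= 1.
Proof.
  intros Hp. unfold rate_dens. pose proof (cdf_max_bounds p x Hp).
  pose proof (Rabs_pos x).
  assert (0 < / (1 + Rabs x)) by (apply Rinv_0_lt_compat; lra).
  assert (/ (1 + Rabs x) <= 1).
  { rewrite <- Rinv_1. apply Rinv_le_contravar; lra. }
  nra.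
Qed.

Lemma rate_perm p q : Permutation p q -> rate p = rate q.
Proof.
  intros H. unfold rate. f_equal. apply Lim_ext. intros b. f_equal.
  unfold cumul. apply RInt_ext. intros x _. unfold rate_dens.
  rewrite (cdf_max_perm _ _ _ H). reflexivity.
Qed.

(** Without users [cdf_max] is 1. Hence [ln (1 + b) - cumul p b] is the integral over [[0, b]] of
    [(1 - cdf_max p x) / (1 + x)], and inductions on the users start here. *)
Lemma cumul_nil b : 0 <= b -> cumul nil b = ln (1 + b).
Proof.
  intros Hb. unfold cumul. apply is_RInt_unique.
  replace (ln (1 + b)) with (minus (ln (1 + b)) (ln (1 + 0))).
  2:{ unfold minus, plus, opp; simpl. rewrite Rplus_0_r, ln_1. ring. }
  apply (is_RInt_derive (fun x => ln (1 + x))).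
  - rewrite Rmin_left, Rmax_right by lra. intros x Hx.
    auto_derive; [lra|]. unfold rate_dens; simpl. rewrite Rabs_right by lra. field. lra.
  - intros x _. apply continuous_rate_dens.
Qed.

(** The difference of [rate_dens p] and [rate_dens (a :: p)]: the density of the rate gained when a
    user with feedback probability [a] joins [p]. *)
Definition tail_dens (a : R) (p : list R) (x : R) : R :=
  Rmin a (ccdf x) * rate_dens p x.

Lemma continuous_tail_dens a p x : continuous (tail_dens a p) x.
Proof.
  apply continuous_Rmult; [|apply continuous_rate_dens].
  apply continuous_Rmin; [apply continuous_const|apply continuous_ccdf].
Qed.

Lemma cumul_cons a p b :
  cumul (a :: p) b = cumul p b - RInt (tail_dens a p) 0 b.
Proof.
  unfold cumul. rewrite <- RInt_Rminus.
  - apply RInt_ext. intros x _. unfold tail_dens, rate_dens. simpl. ring.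
  - apply continuous_ex_RInt, continuous_rate_dens.
  - apply continuous_ex_RInt, continuous_tail_dens.
Qed.

Lemma is_RInt_ccdf s b : is_RInt ccdf s b (rho * (ccdf s - ccdf b)).
Proof.
  replace (rho * (ccdf s - ccdf b)) with (minus (- rho * ccdf b) (- rho * ccdf s)).
  2:{ unfold minus, plus, opp; simpl. ring. }
  apply (is_RInt_derive (fun x => - rho * ccdf x)).
  - intros x _. replace (ccdf x) with (- rho * - (ccdf x / rho)) by (field; lra).
    apply (is_derive_scal ccdf), is_derive_ccdf.
  - intros x _. apply continuous_ccdf.
Qed.

Lemma tail_dens_bounds a p x :
  in01 a -> Forall in01 p -> 0 <= tail_dens a p x <= ccdf x.
Proof.
  intros Ha Hp. unfold tail_dens.
  pose proof (Rmin_ccdf_bounds a x Ha). pose proof (rate_dens_bounds p x Hp).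
  pose proof (Rmin_r a (ccdf x)). nra.
Qed.

(** The integrand is nonnegative and at most [ccdf], whose integrals from 0 stay below [rho]. *)
Lemma tail_lim a p : in01 a -> Forall in01 p ->
  exists l : R, is_lim (RInt (tail_dens a p) 0) p_infty l.
Proof.
  intros Ha Hp. apply is_lim_incr_bounded with rho.
  - intros x y Hxy.
    rewrite <- (RInt_Chasles (V := R_CompleteNormedModule) (tail_dens a p) 0 x y)
      by (apply continuous_ex_RInt, continuous_tail_dens).
    assert (0 <= RInt (tail_dens a p) x y).
    { apply RInt_ge_0; [lra|apply continuous_ex_RInt, continuous_tail_dens|].
      intros z _. apply tail_dens_bounds; assumption. }
    unfold plus; simpl. lra.
  - intros x Hx.
    apply Rle_trans with (RInt ccdf 0 x).
    + apply RInt_le; [lra|apply continuous_ex_RInt, continuous_tail_dens| |].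
      * eexists. apply is_RInt_ccdf.
      * intros z _. apply tail_dens_bounds; assumption.
    + rewrite (is_RInt_unique _ _ _ _ (is_RInt_ccdf 0 x)), ccdf_0.
      pose proof (ccdf_pos x). nra.
Qed.

Lemma rate_eq p (c : R) :
  is_lim (fun b => ln (1 + b) - cumul p b) p_infty c -> rate p = c.
Proof. intros H. unfold rate. rewrite (is_lim_unique _ _ _ H). reflexivity. Qed.

(** [Lim] and [real] return some value in any case; adding the users one at a time, each with a
    finite gain, shows that here it is a genuine finite limit. *)
Lemma rate_correct p : Forall in01 p ->
  is_lim (fun b => ln (1 + b) - cumul p b) p_infty (rate p).
Proof.
  intros Hp.
  assert (exists c : R, is_lim (fun b => ln (1 + b) - cumul p b) p_infty c) as [c Hc].
  { induction Hp as [|a p Ha Hp [c IH]].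
    - exists 0. apply is_lim_ext_loc with (fun _ => 0); [|apply is_lim_const].
      exists 0. intros b Hb. rewrite cumul_nil by lra. ring.
    - destruct (tail_lim a p Ha Hp) as [l Hl]. exists (c + l).
      apply is_lim_ext with (fun b => (ln (1 + b) - cumul p b) + RInt (tail_dens a p) 0 b).
      + intros b. rewrite cumul_cons. ring.
      + apply is_lim_plus'; assumption. }
  rewrite (rate_eq _ _ Hc). exact Hc.
Qed.

Lemma rate_tail a p : in01 a -> Forall in01 p ->
  is_lim (RInt (tail_dens a p) 0) p_infty (rate (a :: p) - rate p).
Proof.
  intros Ha Hp.
  apply is_lim_ext with
    (fun b => (ln (1 + b) - cumul (a :: p) b) + - (ln (1 + b) - cumul p b)).
  { intros b. rewrite cumul_cons. ring. }
  apply is_lim_plus'; [apply rate_correct; constructor; assumption|].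
  apply (is_lim_opp _ _ (rate p)). apply rate_correct, Hp.
Qed.


(** * The iterated expectation equals [rate] *)

Lemma fsinr_ccdf x : 0 < x -> fsinr rho 1 x = ccdf x / rho.
Proof. intros H. unfold fsinr, ccdf. simpl. field. lra. Qed.

(** The boundary term at infinity of the integration by parts below. For large [b],
    [rate p + cumul p b] is within 1 of [ln (1 + b)], hence at most [b + 1] in absolute value, and
    [ccdf] decays exponentially. *)
Lemma cumul_lim p : Forall in01 p ->
  is_lim (fun b => ccdf b * (rate p + cumul p b)) p_infty 0.
Proof.
  intros Hp. pose proof (rate_correct p Hp) as Hr.
  apply is_lim_spec in Hr. destruct (Hr (mkposreal 1 Rlt_0_1)) as [M HM].
  apply is_lim_0_squeeze with (fun x => (x + 1) * ccdf x) (Rmax 0 M);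
    [|apply is_lim_id_ccdf].
  intros x Hx. pose proof (Rmax_l 0 M). pose proof (Rmax_r 0 M).
  specialize (HM x ltac:(lra)). simpl in HM. apply Rabs_def2 in HM.
  assert (ln (1 + x) <= x).
  { rewrite <- (ln_exp x) at 2. apply Rcomplements.ln_le; [lra|].
    left. apply exp_ineq1. lra. }
  assert (0 <= ln (1 + x)).
  { rewrite <- ln_1. apply Rcomplements.ln_le; lra. }
  pose proof (ccdf_pos x).
  rewrite Rabs_mult, (Rabs_right (ccdf x)) by lra.
  rewrite (Rmult_comm (x + 1)). apply Rmult_le_compat_l; [lra|].
  apply Rabs_le. lra.
Qed.

Lemma is_RInt_fsinr_const (g : R -> R) (c b : R) : 0 <= b ->
  (forall x, 0 < x < b -> g x = c) ->
  is_RInt (fun x => fsinr rho 1 x * g x) 0 b (c * (1 - ccdf b)).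
Proof.
  intros Hb Hg.
  apply is_RInt_ext with (fun x => scal (c / rho) (ccdf x)).
  - rewrite Rmin_left, Rmax_right by lra. intros x Hx.
    rewrite fsinr_ccdf, Hg by lra. unfold scal; simpl; unfold mult; simpl. field. lra.
  - replace (c * (1 - ccdf b)) with (scal (c / rho) (rho * (ccdf 0 - ccdf b))).
    + apply (is_RInt_scal (V := R_NormedModule)), is_RInt_ccdf.
    + rewrite ccdf_0. unfold scal; simpl; unfold mult; simpl. field. lra.
Qed.

(** Integration by parts: [- ccdf] is an antiderivative of the density and [H] has derivative
    [rate_dens p]. Above [t] the minimum of [a] and [ccdf x] is [ccdf x], so the remaining integrand
    is [tail_dens a p]. *)
Lemma is_RInt_fsinr_tail (p : list R) (a t s b : R) :
  a = ccdf t -> 0 <= t -> t <= s <= b ->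
  let H x := rate p + cumul p x in
  is_RInt (fun x => fsinr rho 1 x * H x) s b
    (ccdf s * H s - ccdf b * H b
     + (RInt (tail_dens a p) 0 b - RInt (tail_dens a p) 0 s)).
Proof.
  intros Ha Ht Hs H.
  apply is_RInt_ext with (fun x => ccdf x / rho * H x).
  { rewrite Rmin_left, Rmax_right by lra. intros x Hx. rewrite fsinr_ccdf by lra.
    reflexivity. }
  assert (HdH : forall x, is_derive H x (rate_dens p x)).
  { intros x. replace (rate_dens p x) with (0 + rate_dens p x) by ring.
    apply (is_derive_plus (fun _ => rate p) (cumul p)).
    - apply (is_derive_const (K := R_AbsRing) (V := R_NormedModule) (rate p)).
    - apply continuous_is_derive_RInt. intros y. apply continuous_rate_dens. }
  replace (ccdf s * H s - ccdf b * H b + _) with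
    (minus (RInt (tail_dens a p) 0 b - ccdf b * H b)
           (RInt (tail_dens a p) 0 s - ccdf s * H s)).
  2:{ unfold minus, plus, opp; simpl. ring. }
  apply (is_RInt_derive (fun x => RInt (tail_dens a p) 0 x - ccdf x * H x)).
  - rewrite Rmin_left, Rmax_right by lra. intros x Hx.
    replace (ccdf x / rho * H x) with
      (tail_dens a p x - (- (ccdf x / rho) * H x + ccdf x * rate_dens p x)).
    2:{ unfold tail_dens. rewrite Rmin_right.
        - ring.
        - rewrite Ha. apply ccdf_le; lra. }
    apply (is_derive_minus (RInt (tail_dens a p) 0) (fun x => ccdf x * H x)).
    + apply continuous_is_derive_RInt. intros y. apply continuous_tail_dens.
    + apply (is_derive_mult (ccdf) H).
      * apply is_derive_ccdf.
      * apply HdH.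
      * intros u v. apply Rmult_comm.
  - intros x _. apply continuous_Rmult.
    + apply (continuous_Rmult (ccdf) (fun _ => / rho));
        [apply continuous_ccdf|apply continuous_const].
    + apply (ex_derive_continuous (V := R_NormedModule)). eexists. apply HdH.
Qed.

Lemma fbprob_Some t : fbprob rho (Some t) = ccdf t.
Proof. simpl. unfold Fsinr, ccdf. simpl. field. Qed.

Lemma fbprob_in01 t : valid_thr t -> in01 (fbprob rho t).
Proof.
  destruct t as [t|]; intros Ht.
  - rewrite fbprob_Some. simpl in Ht. split; [left; apply ccdf_pos|].
    apply ccdf_le1; assumption.
  - simpl. unfold in01. lra.
Qed.

(** Integrates out one user: [m] is the maximum reached so far, and the users in [p] are already
    averaged over. *)
Lemma int0inf_step (p : list R) (t : option R) (m : R) :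
  Forall in01 p -> valid_thr t -> 0 <= m ->
  int0inf (fun x => fsinr rho 1 x *
             (rate p + cumul p (Rmax m (trunc t x)))) =
  rate (fbprob rho t :: p) + cumul (fbprob rho t :: p) m.
Proof.
  intros Hp Ht Hm. pose proof (fbprob_in01 t Ht) as Ha.
  destruct t as [t|].
  - simpl in Ht. rewrite fbprob_Some in *. set (a := ccdf t) in *.
    set (H := fun x => rate p + cumul p x).
    set (T := RInt (tail_dens a p) 0).
    set (g := fun x => H (Rmax m (trunc (Some t) x))).
    (* Below [s] the running maximum stays [m], since [x] is either truncated to 0 or at most [m];
       above [s] it equals [x]. *)
    set (s := Rmax m t).
    pose proof (Rmax_l m t) as Hms. pose proof (Rmax_r m t) as Hts. fold s in Hms, Hts.
    assert (Hlow : forall b, 0 <= b <= s ->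
      is_RInt (fun x => fsinr rho 1 x * g x) 0 b (H m * (1 - ccdf b))).
    { intros b Hb. apply is_RInt_fsinr_const; [lra|]. intros x Hx.
      unfold g, trunc. destruct (Rle_dec t x) as [h|h].
      - rewrite Rmax_left; [reflexivity|].
        assert (x < s) as Hxs by lra. unfold s, Rmax in Hxs.
        destruct Rle_dec in Hxs; lra.
      - rewrite Rmax_left by lra. reflexivity. }
    assert (Hall : forall b, s <= b ->
      is_RInt (fun x => fsinr rho 1 x * g x) 0 b
        (H m * (1 - ccdf s)
         + (ccdf s * H s - ccdf b * H b + (T b - T s)))).
    { intros b Hb.
      apply (is_RInt_Chasles (V := R_NormedModule) _ 0 s b).
      - apply Hlow. lra.
      - apply is_RInt_ext with (fun x => fsinr rho 1 x * H x).
        + rewrite Rmin_left, Rmax_right by lra. intros x Hx.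
          unfold g, trunc. destruct (Rle_dec t x) as [h|h]; [|lra].
          rewrite Rmax_right by lra. reflexivity.
        + apply is_RInt_fsinr_tail with t; [reflexivity|assumption|lra]. }
    fold g.
    apply (int0inf_eq _ (fun b => H m * (1 - ccdf s)
         + (ccdf s * H s - ccdf b * H b + (T b - T s))) s).
    + intros b Hb. destruct (Rle_dec b s).
      * eexists. apply Hlow. lra.
      * eexists. apply Hall. lra.
    + exact Hall.
    + replace (rate (a :: p) + cumul (a :: p) m) with
        ((H m * (1 - ccdf s) + ccdf s * H s - T s)
         + (- 0 + (rate (a :: p) - rate p))).
      * apply is_lim_ext with
          (fun b => (H m * (1 - ccdf s) + ccdf s * H s - T s)
                    + (- (ccdf b * H b) + T b)).
        { intros b. ring. }
        apply is_lim_plus'; [apply is_lim_const|].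
        apply is_lim_plus'.
        -- apply (is_lim_opp _ _ 0). apply cumul_lim, Hp.
        -- apply rate_tail; assumption.
      * rewrite cumul_cons. fold T.
        (* If [m <= t], the minimum of [a] and [ccdf x] is the constant [a = ccdf s] between [m] and
           [s = t]; otherwise [s = m] and both sides vanish. *)
        assert (T s - T m = ccdf s * (H s - H m)) as HT.
        { unfold s, Rmax. destruct (Rle_dec m t) as [h|h]; [|ring].
          unfold H, T, cumul.
          rewrite <- (RInt_Chasles (V := R_CompleteNormedModule) (tail_dens a p) 0 m t)
            by (apply continuous_ex_RInt; intros; apply continuous_tail_dens).
          rewrite <- (RInt_Chasles (V := R_CompleteNormedModule) (rate_dens p) 0 m t)
            by (apply continuous_ex_RInt; intros; apply continuous_rate_dens).
          replace (RInt (tail_dens a p) m t) with (a * RInt (rate_dens p) m t).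
          - unfold plus; simpl. fold a. ring.
          - symmetry. apply is_RInt_unique.
            apply is_RInt_ext with (fun x => scal a (rate_dens p x)).
            + rewrite Rmin_left, Rmax_right by lra. intros x Hx.
              unfold tail_dens. rewrite Rmin_left; [reflexivity|].
              apply ccdf_le; lra.
            + apply (is_RInt_scal (V := R_NormedModule)).
              apply (RInt_correct (V := R_CompleteNormedModule)).
              apply continuous_ex_RInt, continuous_rate_dens. }
        assert (H m = rate p + cumul p m) as HHm by reflexivity.
        nra.
  - simpl. rewrite Rmax_left by exact Hm.
    (* An infinite threshold gives feedback probability 0, which contributes a factor 1. *)
    assert (cdf_max (0 :: p) = cdf_max p) as E.
    { apply functional_extensionality. intros x. simpl.
      pose proof (ccdf_pos x). rewrite Rmin_left by lra. ring. }
    replace (rate (0 :: p) + cumul (0 :: p) m) with (rate p + cumul p m)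
      by (unfold rate, cumul, rate_dens; rewrite E; reflexivity).
    set (c := rate p + cumul p m).
    apply (int0inf_eq _ (fun b => c * (1 - ccdf b)) 0).
    + intros b Hb. eexists. apply (is_RInt_fsinr_const (fun _ => c)); auto.
    + intros b Hb. apply (is_RInt_fsinr_const (fun _ => c)); auto.
    + replace (Finite c) with (Rbar_mult c (1 - 0)) by (simpl; f_equal; ring).
      apply (is_lim_scal_l _ c p_infty (1 - 0)). apply is_lim_minus'; [apply is_lim_const|].
      apply is_lim_ccdf.
Qed.

Lemma maxR_nonneg l : 0 <= maxR l.
Proof. induction l as [|x l IH]; simpl; [lra|]. pose proof (Rmax_r x (maxR l)). lra. Qed.

(** Generalizing over the maximum [m] fixed by the outer integrals makes the induction work. The
    right-hand side is [ln (1 + m)] plus the integral of [(1 - cdf_max) / (1 + x)] from [m] to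
    infinity. *)
Lemma expect_iid_rate (tau : list (option R)) : Forall valid_thr tau ->
  forall m, 0 <= m ->
  expect_iid (fsinr rho 1) (length tau)
    (fun gs => ln (1 + Rmax m
       (maxR (map (fun tg => trunc (fst tg) (snd tg)) (combine tau gs))))) =
  rate (map (fbprob rho) tau) + cumul (map (fbprob rho) tau) m.
Proof.
  induction 1 as [|t tau Ht Htau IH]; intros m Hm; simpl.
  - rewrite Rmax_left, cumul_nil by lra.
    rewrite (rate_eq nil 0); [ring|].
    apply is_lim_ext_loc with (fun _ => 0); [|apply is_lim_const].
    exists 0. intros b Hb. rewrite cumul_nil by lra. ring.
  - rewrite <- int0inf_step; [| |assumption..].
    2:{ apply Forall_map. eapply Forall_impl; [|exact Htau]. apply fbprob_in01. }
    f_equal. apply functional_extensionality. intros x. f_equal.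
    rewrite <- IH.
    + f_equal. apply functional_extensionality. intros xs. simpl.
      rewrite Rmax_assoc. reflexivity.
    + pose proof (Rmax_l m (trunc t x)). lra.
Qed.

Lemma sumrate_rate (tau : list (option R)) : Forall valid_thr tau ->
  sumrate rho tau = rate (map (fbprob rho) tau).
Proof.
  intros H.
  transitivity (rate (map (fbprob rho) tau) + cumul (map (fbprob rho) tau) 0).
  - rewrite <- expect_iid_rate by (assumption || lra).
    unfold sumrate. f_equal. apply functional_extensionality. intros gs.
    rewrite Rmax_right by apply maxR_nonneg. reflexivity.
  - unfold cumul. rewrite RInt_point. unfold zero; simpl. ring.
Qed.

Lemma Finv_correct (p : R) : in01 p ->
  valid_thr (Finv rho (1 - p)) /\ fbprob rho (Finv rho (1 - p)) = p.
Proof.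
  intros [H0 H1]. unfold Finv. destruct Req_EM_T as [E|E]; [simpl; lra|].
  assert (0 < p) by lra.
  assert (exists x, 0 <= x /\ Fsinr rho 1 x = 1 - p) as Hex.
  { exists (- rho * ln p). split.
    - assert (ln p <= 0) by (rewrite <- ln_1; apply Rcomplements.ln_le; lra). nra.
    - unfold Fsinr. simpl. replace (- (- rho * ln p) / rho) with (ln p) by (field; lra).
      rewrite exp_ln by lra. field. }
  pose proof (epsilon_spec (inhabits 0) _ Hex) as [Hx HF].
  split; [exact Hx|]. simpl. lra.
Qed.

Lemma fbprob_Finv (p : list R) : Forall in01 p ->
  Forall valid_thr (map (fun pi => Finv rho (1 - pi)) p) /\
  map (fbprob rho) (map (fun pi => Finv rho (1 - pi)) p) = p.
Proof.
  induction 1 as [|a p Ha _ [IH1 IH2]]; simpl; [auto|].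
  destruct (Finv_correct a Ha) as [Hv Hf].
  split; [constructor; assumption|]. rewrite Hf, IH2. reflexivity.
Qed.

Lemma sumrate_p_rate (p : list R) : Forall in01 p -> sumrate_p rho p = rate p.
Proof.
  intros H. destruct (fbprob_Finv p H) as [Hv Hf].
  unfold sumrate_p. rewrite sumrate_rate by exact Hv. rewrite Hf. reflexivity.
Qed.

(** * Transferring feedback probability between two users *)

(** Change in the probability that both truncated SINRs stay below the level [x] with [ccdf x = u],
    when [(a, b)] becomes [(a', b')]. *)
Definition pair_gain (a b a' b' u : R) : R :=
  (1 - Rmin a' u) * (1 - Rmin b' u) - (1 - Rmin a u) * (1 - Rmin b u).

Lemma continuous_pair (a b u : R) :
  continuous (fun u => (1 - Rmin a u) * (1 - Rmin b u)) u.
Proof.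
  apply continuous_Rmult; apply continuous_Rminus; try apply continuous_const;
    (apply continuous_Rmin; [apply continuous_const|apply continuous_id]).
Qed.

Lemma continuous_pair_gain a b a' b' u : continuous (pair_gain a b a' b') u.
Proof. apply continuous_Rminus; apply continuous_pair. Qed.

(** For a fixed sum the closed form increases with the difference [a - b], so balancing a pair
    lowers the integral. *)
Lemma RInt_pair (a b : R) : 0 <= b <= a -> a <= 1 ->
  RInt (fun u => (1 - Rmin a u) * (1 - Rmin b u)) 0 1 =
  / 3 + ((2 - (a + b)) ^ 3 + (a - b) ^ 3) / 12.
Proof.
  intros Hba Ha. apply is_RInt_unique.
  assert (Hpiece : forall (f F : R -> R) x y, x <= y ->
    (forall u, is_derive F u (f u)) -> (forall u, continuous f u) ->
    (forall u, x < u < y -> f u = (1 - Rmin a u) * (1 - Rmin b u)) ->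
    is_RInt (fun u => (1 - Rmin a u) * (1 - Rmin b u)) x y (F y - F x)).
  { intros f F x y Hxy HF Hf E. apply is_RInt_ext with f.
    - rewrite Rmin_left, Rmax_right by lra. exact E.
    - apply (is_RInt_derive F); intros; auto. }
  assert (Hc : forall (f : R -> R) u, ex_derive f u -> continuous f u)
    by (intros; apply (ex_derive_continuous (V := R_NormedModule)); assumption).
  (* The value is left open and assembled from the pieces [[0, b]], [[b, a]] and [[a, 1]]; [field]
     then matches it with the closed form. *)
  evar (l : R).
  assert (Hl : is_RInt (fun u => (1 - Rmin a u) * (1 - Rmin b u)) 0 1 l).
  { apply (is_RInt_Chasles (V := R_NormedModule) _ 0 b 1);
      [|apply (is_RInt_Chasles (V := R_NormedModule) _ b a 1)].
    - apply (Hpiece (fun u => (1 - u) ^ 2) (fun u => - (1 - u) ^ 3 / 3)).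
      + lra.
      + intros u. auto_derive; [exact Logic.I|]. field.
      + intros u. apply Hc. auto_derive. exact Logic.I.
      + intros u Hu. rewrite !Rmin_right by lra. ring.
    - apply (Hpiece (fun u => (1 - b) * (1 - u)) (fun u => - (1 - b) * (1 - u) ^ 2 / 2)).
      + lra.
      + intros u. auto_derive; [exact Logic.I|]. field.
      + intros u. apply Hc. auto_derive. exact Logic.I.
      + intros u Hu. rewrite Rmin_right, Rmin_left by lra. ring.
    - apply (Hpiece (fun u => (1 - a) * (1 - b)) (fun u => (1 - a) * (1 - b) * u)).
      + lra.
      + intros u. auto_derive; [exact Logic.I|]. ring.
      + intros u. apply continuous_const.
      + intros u Hu. rewrite !Rmin_left by lra. ring. }
  replace (/ 3 + ((2 - (a + b)) ^ 3 + (a - b) ^ 3) / 12) with l; [exact Hl|].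
  unfold l, plus; simpl. field.
Qed.

Section Pair.

Variables a b a' b' : R.
Hypothesis Hb : 0 <= b.
Hypothesis Hb' : b < b'.
Hypothesis Hab' : b' <= a'.
Hypothesis Ha : a <= 1.
Hypothesis Hsum : a + b = a' + b'.

Let gain := pair_gain a b a' b'.

Lemma RInt_pair_gain_le0 : RInt gain 0 1 <= 0.
Proof.
  unfold gain, pair_gain.
  rewrite RInt_Rminus by (apply continuous_ex_RInt; intros; apply continuous_pair).
  rewrite !RInt_pair by lra. rewrite Hsum.
  assert ((a' - b') ^ 3 <= (a - b) ^ 3) by (apply pow_incr; lra). lra.
Qed.

Lemma pair_gain_ge u : 0 <= u -> -1 <= gain u.
Proof.
  intros Hu. unfold gain, pair_gain.
  assert (forall c, 0 <= c <= 1 -> 0 <= 1 - Rmin c u <= 1) as H.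
  { intros c Hc. unfold Rmin. destruct Rle_dec; lra. }
  pose proof (H a ltac:(lra)). pose proof (H b ltac:(lra)).
  pose proof (H a' ltac:(lra)). pose proof (H b' ltac:(lra)). nra.
Qed.

(** The zero of the gain on [[a', a]], where only the minimum of [a] and [u] still depends on [u]:
    the solution of [(1 - u) (1 - b) = (1 - a') (1 - b')]. *)
Definition pair_crossing : R := 1 - (1 - a') * (1 - b') / (1 - b).

Lemma pair_crossing_eq : (1 - b) * (1 - pair_crossing) = (1 - a') * (1 - b').
Proof. unfold pair_crossing. field. lra. Qed.

(** The lower bound follows from [b < b']. The upper one holds because, for equal sums, the more
    balanced pair has the larger product of complements. *)
Lemma pair_crossing_bounds : a' <= pair_crossing <= a.
Proof.
  pose proof pair_crossing_eq. split.
  - apply Rnot_lt_le. intros h. nra.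
  - apply Rnot_lt_le. intros h.
    assert ((1 - b) * (1 - a) <= (1 - a') * (1 - b')) by nra. nra.
Qed.

Lemma pair_gain_pos u : pair_crossing <= u -> 0 <= gain u.
Proof.
  intros Hu. pose proof pair_crossing_bounds. pose proof pair_crossing_eq.
  unfold gain, pair_gain.
  rewrite (Rmin_left a'), (Rmin_left b'), (Rmin_left b) by lra.
  assert (pair_crossing <= Rmin a u) by (apply Rmin_glb; lra). nra.
Qed.

Lemma pair_gain_neg u : 0 <= u <= pair_crossing -> gain u <= 0.
Proof.
  intros Hu. pose proof pair_crossing_bounds. pose proof pair_crossing_eq.
  unfold gain, pair_gain. rewrite (Rmin_right a) by lra.
  (* Up to [a'] the first factors agree and [b < b'] decides; beyond it the old product
     [(1 - u) (1 - b)] decreases to the new one, reached at the crossing. *)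
  destruct (Rle_dec u a').
  - rewrite (Rmin_right a') by lra.
    assert (Rmin b u <= Rmin b' u) by (apply Rle_min_compat_r; lra). nra.
  - rewrite (Rmin_left a'), (Rmin_left b'), (Rmin_left b) by lra. nra.
Qed.

End Pair.

(* Up to the factor [rho], the weight obtained from [1 / (1 + x)] by the
   substitution [u = ccdf x]; its monotonicity is where [rho <= 1] is needed. *)
Lemma weight_le x y : rho <= 1 -> 0 <= x <= y ->
  / ((1 + x) * ccdf x) <= / ((1 + y) * ccdf y).
Proof.
  intros Hrho Hxy.
  pose proof (ccdf_pos x). pose proof (ccdf_pos y).
  apply Rinv_le_contravar; [nra|].
  replace (ccdf x) with (ccdf y * exp ((y - x) / rho)).
  2:{ unfold ccdf. rewrite <- exp_plus. f_equal. field. lra. }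
  assert (1 + (y - x) <= exp ((y - x) / rho)).
  { apply Rle_trans with (1 + (y - x) / rho).
    - assert (1 <= / rho) by (rewrite <- Rinv_1; apply Rinv_le_contravar; lra).
      unfold Rdiv. nra.
    - destruct (Req_dec ((y - x) / rho) 0) as [E|E].
      + rewrite E, exp_0. lra.
      + left. apply exp_ineq1, E. }
  assert (1 + y <= (1 + x) * exp ((y - x) / rho)) by nra. nra.
Qed.

(** Substitution [u = ccdf x], with [du = - (u / rho) dx]. *)
Lemma RInt_comp_ccdf (f : R -> R) (b : R) : (forall u, continuous f u) ->
  is_RInt (fun x => f (ccdf x) * ccdf x) 0 b
    (rho * (RInt f 0 1 - RInt f 0 (ccdf b))).
Proof.
  intros Hf.
  replace (rho * (RInt f 0 1 - RInt f 0 (ccdf b))) with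
    (minus (- rho * RInt f 0 (ccdf b)) (- rho * RInt f 0 (ccdf 0))).
  2:{ rewrite ccdf_0. unfold minus, plus, opp; simpl. ring. }
  apply (is_RInt_derive (fun x => - rho * RInt f 0 (ccdf x))).
  - intros x _.
    replace (f (ccdf x) * ccdf x) with (- rho * (- (ccdf x / rho) * f (ccdf x)))
      by (field; lra).
    apply (is_derive_scal (fun x => RInt f 0 (ccdf x))).
    apply (is_derive_comp (RInt f 0) ccdf).
    + apply continuous_is_derive_RInt, Hf.
    + apply is_derive_ccdf.
  - intros x _. apply continuous_Rmult; [|apply continuous_ccdf].
    apply (continuous_comp ccdf f); [apply continuous_ccdf|apply Hf].
Qed.

(* The gain changes sign once, from minus to plus as [u = ccdf x] grows, and the
   weight in front of it decreases in [u]: replacing the weight by its value at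
   the crossing point bounds the change of rate by the unweighted integral. *)
Lemma cumul_transfer (p : list R) (a b a' b' : R) : rho <= 1 -> Forall in01 p ->
  0 <= b -> b < b' -> b' <= a' -> a <= 1 -> a + b = a' + b' ->
  exists C, 0 <= C /\ forall B, 0 <= B ->
    cumul (a' :: b' :: p) B - cumul (a :: b :: p) B <= C * ccdf B.
Proof.
  intros Hrho Hp Hb Hb' Hab' Ha Hsum.
  set (D := pair_gain a b a' b').
  set (uc := pair_crossing b a' b').
  assert (a' <= uc <= a) as Huc by (apply pair_crossing_bounds; lra).
  set (xc := - rho * ln uc).
  assert (Hxc : ccdf xc = uc).
  { unfold ccdf, xc. replace (- (- rho * ln uc) / rho) with (ln uc) by (field; lra).
    apply exp_ln. lra. }
  assert (0 <= xc).
  { assert (ln uc <= 0) by (rewrite <- ln_1; apply Rcomplements.ln_le; lra).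
    unfold xc. nra. }
  (* What remains of the integrand once the gain and the Jacobian factor [ccdf x] are taken out.
     Both factors of [V] increase with [x], the first because [rho <= 1]. *)
  set (V := fun x => / ((1 + x) * ccdf x) * cdf_max p x).
  assert (HVpos : forall x, 0 <= x -> 0 <= V x).
  { intros x Hx. unfold V. pose proof (ccdf_pos x).
    apply Rmult_le_pos; [|apply cdf_max_bounds, Hp].
    left. apply Rinv_0_lt_compat. nra. }
  assert (HV : forall x y, 0 <= x <= y -> V x <= V y).
  { intros x y Hxy. unfold V. pose proof (ccdf_pos x).
    apply Rmult_le_compat.
    - left. apply Rinv_0_lt_compat. nra.
    - apply cdf_max_bounds, Hp.
    - apply weight_le; assumption.
    - apply cdf_max_le; [exact Hp|lra]. }
  assert (Hpt : forall x, 0 <= x ->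
    rate_dens (a' :: b' :: p) x - rate_dens (a :: b :: p) x
    <= V xc * (D (ccdf x) * ccdf x)).
  { intros x Hx. pose proof (ccdf_pos x).
    replace (rate_dens (a' :: b' :: p) x - rate_dens (a :: b :: p) x)
      with (V x * (D (ccdf x) * ccdf x)).
    2:{ unfold V, rate_dens, D, pair_gain. simpl. rewrite Rabs_right by lra.
        field. split; lra. }
    destruct (Rle_dec x xc) as [h|h].
    - pose proof (ccdf_le x xc h). rewrite Hxc in *.
      assert (0 <= D (ccdf x)) by (apply pair_gain_pos; assumption || lra).
      apply Rmult_le_compat_r; [nra|]. apply HV; lra.
    - pose proof (ccdf_le xc x ltac:(lra)). rewrite Hxc in *.
      assert (D (ccdf x) <= 0) by (apply pair_gain_neg; try assumption; fold uc; lra).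
      pose proof (HV xc x ltac:(lra)).
      assert (D (ccdf x) * ccdf x <= 0) by nra. nra. }
  assert (HD : forall u, continuous D u) by (intros; apply continuous_pair_gain).
  (* Truncation at [B] omits the values [u < ccdf B]; as the gain is at least -1, this costs at most
     [V xc * rho * ccdf B], which vanishes as [B] grows. *)
  exists (V xc * rho). split.
  { pose proof (HVpos xc ltac:(lra)). nra. }
  intros B HB. unfold cumul.
  rewrite <- RInt_Rminus by (apply continuous_ex_RInt, continuous_rate_dens).
  assert (HI : is_RInt (fun x => scal (V xc) (D (ccdf x) * ccdf x)) 0 B
    (scal (V xc) (rho * (RInt D 0 1 - RInt D 0 (ccdf B))))).
  { apply (is_RInt_scal (V := R_NormedModule)), RInt_comp_ccdf, HD. }
  apply Rle_trans with (V xc * (rho * (RInt D 0 1 - RInt D 0 (ccdf B)))).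
  - change (V xc * (rho * (RInt D 0 1 - RInt D 0 (ccdf B)))) with
      (scal (V xc) (rho * (RInt D 0 1 - RInt D 0 (ccdf B)))).
    rewrite <- (is_RInt_unique _ _ _ _ HI).
    apply RInt_le; [exact HB| |eexists; exact HI|].
    + apply continuous_ex_RInt. intros x. apply continuous_Rminus; apply continuous_rate_dens.
    + intros x Hx. apply Hpt. lra.
  - rewrite Rmult_assoc. apply Rmult_le_compat_l; [apply HVpos; lra|].
    apply Rmult_le_compat_l; [lra|].
    assert (RInt D 0 1 <= 0) by (apply RInt_pair_gain_le0; assumption).
    pose proof (ccdf_pos B).
    assert (- ccdf B <= RInt D 0 (ccdf B)); [|lra].
    replace (- ccdf B) with (RInt (fun _ => -1) 0 (ccdf B)).
    + apply RInt_le; [lra| |apply continuous_ex_RInt, HD|].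
      * apply continuous_ex_RInt. intros; apply continuous_const.
      * intros u Hu. apply pair_gain_ge; assumption || lra.
    + rewrite (RInt_const (V := R_CompleteNormedModule)).
      unfold scal; simpl; unfold mult; simpl. ring.
Qed.

Lemma rate_transfer (p : list R) (a b a' b' : R) : rho <= 1 -> Forall in01 p ->
  in01 a -> in01 b -> b <= a' <= a -> a + b = a' + b' ->
  rate (a :: b :: p) <= rate (a' :: b' :: p).
Proof.
  intros Hrho Hp Ha Hb Hab Hsum.
  assert (Hord : forall c d, b < d -> d <= c -> a + b = c + d ->
    rate (a :: b :: p) <= rate (c :: d :: p)).
  { intros c d Hd Hdc E. unfold in01 in *.
    destruct (cumul_transfer p a b c d) as [C [HC H]]; try lra; [exact Hp|].
    assert (Rbar_le (rate (a :: b :: p) - rate (c :: d :: p)) 0) as Hle.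
    { apply (is_lim_le_loc
        (fun B => (ln (1 + B) - cumul (a :: b :: p) B)
                  - (ln (1 + B) - cumul (c :: d :: p) B))
        (fun B => C * ccdf B) p_infty).
      - exists 0. intros B HB. specialize (H B ltac:(lra)). lra.
      - apply is_lim_minus'; apply rate_correct; repeat apply Forall_cons;
          solve [exact Hp | unfold in01; lra].
      - replace (Finite 0) with (Rbar_mult C 0) by (simpl; f_equal; ring).
        apply (is_lim_scal_l _ C p_infty 0). apply is_lim_ccdf. }
    simpl in Hle. lra. }
  (* What is left are the trivial transfer, the plain exchange, and the two possible orders of [a']
     and [b']. *)
  destruct (Req_dec a' a) as [->|].
  { replace b' with b by lra. lra. }
  destruct (Req_dec a' b) as [->|].
  { replace b' with a by lra. rewrite (rate_perm (a :: b :: p) (b :: a :: p)) by constructor.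
    lra. }
  destruct (Rle_dec b' a').
  - apply Hord; lra.
  - rewrite (rate_perm (a' :: b' :: p) (b' :: a' :: p)) by constructor. apply Hord; lra.
Qed.

End Rate.

(** * Majorization and transfers *)

(** Symmetry and monotonicity under Robin Hood transfers. Permutation invariance allows the transfer
    to be stated for the first two entries only. *)
Definition transfer_monotone (phi : list R -> R) : Prop :=
  (forall p q, Permutation p q -> phi p = phi q) /\
  (forall p a b a' b', Forall in01 p -> in01 a -> in01 b ->
     b <= a' <= a -> a + b = a' + b' -> phi (a :: b :: p) <= phi (a' :: b' :: p)).

(** Lets an induction freeze an entry that has reached its final value. *)
Lemma transfer_monotone_cons (phi : list R -> R) (c : R) :
  in01 c -> transfer_monotone phi -> transfer_monotone (fun p => phi (c :: p)).
Proof.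
  intros Hc [Hperm Htr]. split.
  - intros p q H. apply Hperm. constructor. exact H.
  - intros p a b a' b' Hp Ha Hb Hab Hsum.
    rewrite (Hperm (c :: a :: b :: p) (a :: b :: c :: p)).
    2:{ apply (Permutation_middle (a :: b :: nil) p c). }
    rewrite (Hperm (c :: a' :: b' :: p) (a' :: b' :: c :: p)).
    2:{ apply (Permutation_middle (a' :: b' :: nil) p c). }
    apply Htr; try assumption. constructor; assumption.
Qed.

Lemma sumR_app (l1 l2 : list R) : sumR (l1 ++ l2) = sumR l1 + sumR l2.
Proof. induction l1 as [|x l1 IH]; simpl; lra. Qed.

Lemma sumR_ge (c : R) (l : list R) :
  Forall (fun x => c <= x) l -> INR (length l) * c <= sumR l.
Proof.
  induction 1; [simpl; lra|]. cbn [length sumR fold_right]. rewrite S_INR. unfold sumR in *. lra.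
Qed.

Lemma sumR_le (c : R) (l : list R) :
  Forall (fun x => x <= c) l -> sumR l <= INR (length l) * c.
Proof.
  induction 1; [simpl; lra|]. cbn [length sumR fold_right]. rewrite S_INR. unfold sumR in *. lra.
Qed.

Lemma Forall_firstn (P : R -> Prop) (k : nat) (l : list R) :
  Forall P l -> Forall P (firstn k l).
Proof.
  intros H. rewrite <- (firstn_skipn k l) in H. apply Forall_app in H. apply H.
Qed.

Lemma first_le_split (c : R) (l : list R) :
  Forall (fun x => c <= x) l \/
  exists l1 z l2, l = l1 ++ z :: l2 /\ Forall (fun x => c <= x) l1 /\ z <= c.
Proof.
  induction l as [|x l IH]; [left; constructor|].
  destruct (Rle_dec x c) as [h|h].
  - right. exists nil, x, l. auto.
  - destruct IH as [IH|(l1 & z & l2 & -> & H1 & Hz)].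
    + left. constructor; [lra|exact IH].
    + right. exists (x :: l1), z, l2. split; [reflexivity|].
      split; [constructor; [lra|exact H1]|exact Hz].
Qed.

(** One transfer turns the head [x] into [y] by moving the surplus to the first later entry
    [z <= y]; the head is then frozen. Since a transfer can destroy the order of [xs], only [ys] is
    assumed sorted. *)
Lemma prefix_majorized_le (ys : list R) : forall (phi : list R -> R) (xs : list R),
  transfer_monotone phi -> length xs = length ys ->
  Forall in01 xs -> Forall in01 ys -> StronglySorted Rge ys ->
  (forall k, (k <= length xs)%nat -> sumR (firstn k ys) <= sumR (firstn k xs)) ->
  sumR xs = sumR ys -> phi xs <= phi ys.
Proof.
  induction ys as [|y ys IH]; intros phi xs Hphi Hlen Hx Hy Hsort Hpre Hsum.
  { destruct xs; [lra|discriminate]. }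
  destruct xs as [|x xs]; [discriminate|].
  injection Hlen as Hlen.
  inversion Hx as [|? ? Hx1 Hxs]; subst. inversion Hy as [|? ? Hy1 Hys]; subst.
  inversion Hsort as [|? ? Hsys Hge]; subst.
  assert (y <= x) as Hyx.
  { specialize (Hpre 1%nat ltac:(simpl; lia)). simpl in Hpre. lra. }
  assert (Forall (fun z => z <= y) ys) as Hle.
  { eapply Forall_impl; [|exact Hge]. simpl. intros; lra. }
  destruct (first_le_split y xs) as [Hall|(l1 & z & l2 & -> & H1 & Hz)].
  (* No later entry can take a surplus, but equality of the sums then forces [x = y]. *)
  - pose proof (sumR_ge y xs Hall). pose proof (sumR_le y ys Hle).
    rewrite Hlen in H. simpl in Hsum.
    assert (x = y) as -> by lra.
    apply (IH (fun p => phi (y :: p))); try assumption; [| |lra].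
    + apply transfer_monotone_cons; assumption.
    + intros k Hk. specialize (Hpre (S k) ltac:(simpl; lia)). simpl in Hpre. lra.
  - apply Forall_app in Hxs as [Hl1 Hl2]. inversion Hl2 as [|? ? Hz1 Hl2']; subst.
    set (w := x + z - y).
    rewrite (proj1 Hphi _ (x :: z :: l1 ++ l2)).
    2:{ constructor. symmetry. apply Permutation_middle. }
    apply Rle_trans with (phi (y :: w :: l1 ++ l2)).
    { apply (proj2 Hphi); try assumption; [|lra|unfold w; lra].
      apply Forall_app. auto. }
    rewrite (proj1 Hphi (y :: w :: l1 ++ l2) (y :: l1 ++ w :: l2)).
    2:{ constructor. apply Permutation_middle. }
    rewrite length_app in Hlen. simpl in Hlen.
    apply (IH (fun p => phi (y :: p))).
    + apply transfer_monotone_cons; assumption.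
    + rewrite length_app. exact Hlen.
    + apply Forall_app. split; [exact Hl1|]. constructor; [|exact Hl2'].
      unfold w, in01 in *. lra.
    + exact Hys.
    + exact Hsys.
    + intros k Hk. rewrite length_app in Hk. simpl in Hk.
      (* Prefixes ending before [w] have all entries at least [y], while those of [ys] are at most
         [y]. Longer ones contain [w], hence the whole surplus, and inherit the old inequality for
         [S k]. *)
      destruct (Nat.le_gt_cases k (length l1)) as [h|h].
      * pose proof (sumR_ge y _ (Forall_firstn _ k _ H1)) as Hg.
        pose proof (sumR_le y _ (Forall_firstn _ k _ Hle)) as Hl.
        rewrite length_firstn in Hg, Hl.
        rewrite Nat.min_l in Hg, Hl by lia.
        rewrite firstn_app. replace (k - length l1)%nat with 0%nat by lia.
        rewrite sumR_app. simpl. lra.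
      * assert (k = length l1 + S (k - length l1 - 1))%nat as Ek by lia.
        specialize (Hpre (S k)). rewrite Ek in *.
        set (j := (k - length l1 - 1)%nat) in *.
        simpl in Hpre. rewrite firstn_app_2, sumR_app in Hpre.
        rewrite firstn_app_2, sumR_app. simpl in *.
        rewrite length_app in Hpre. simpl in Hpre.
        specialize (Hpre ltac:(lia)). unfold w. lra.
    + simpl in Hsum. rewrite sumR_app in *. simpl in *. unfold w. lra.
Qed.

Lemma majorizes_le (phi : list R -> R) (x y : list R) :
  transfer_monotone phi -> Forall in01 x -> Forall in01 y ->
  majorizes x y -> phi x <= phi y.
Proof.
  intros Hphi Hx Hy (Hlen & xs & ys & Px & _ & Py & Sy & Hpre & Hsum).
  rewrite (proj1 Hphi _ _ Px), (proj1 Hphi _ _ Py).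
  pose proof (Permutation_length Px) as Lx. pose proof (Permutation_length Py).
  apply prefix_majorized_le; try assumption.
  - congruence.
  - rewrite <- Px. exact Hx.
  - rewrite <- Py. exact Hy.
  - apply Sorted_StronglySorted; [|exact Sy]. intros u v w. apply Rge_trans.
  - rewrite <- Lx. exact Hpre.
Qed.

(** Otherwise all entries would lie strictly on the same side of the mean [c] as [a], against the
    value of the sum. *)
Lemma exists_opposite (a c : R) (l : list R) :
  a <> c -> a + sumR l = INR (S (length l)) * c ->
  exists z, In z l /\ (z <= c <= a \/ a <= c <= z).
Proof.
  intros Hac Hsum. apply NNPP. intros Hn. rewrite S_INR in Hsum.
  destruct (Rle_dec a c).
  - assert (sumR l <= INR (length l) * c); [|lra].
    apply sumR_le, Forall_forall. intros z Hz.
    apply Rnot_lt_le. intros h. apply Hn. exists z. split; [exact Hz|lra].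
  - assert (INR (length l) * c <= sumR l); [|lra].
    apply sumR_ge, Forall_forall. intros z Hz.
    apply Rnot_lt_le. intros h. apply Hn. exists z. split; [exact Hz|lra].
Qed.

(** A transfer with an entry on the other side of the mean sets the head to [c] exactly; the other
    entries keep mean [c], and the induction continues on them. *)
Lemma mean_le (c : R) (n : nat) : forall (phi : list R -> R) (xs : list R),
  transfer_monotone phi -> length xs = n -> Forall in01 xs ->
  sumR xs = INR n * c -> phi xs <= phi (repeat c n).
Proof.
  induction n as [|n IH]; intros phi xs Hphi Hlen Hx Hsum.
  { destruct xs; [simpl; lra|discriminate]. }
  destruct xs as [|a l]; [discriminate|]. injection Hlen as Hlen.
  inversion Hx as [|? ? Ha Hl]; subst. cbn [repeat].
  destruct (Req_dec a c) as [->|Hac].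
  - apply (IH (fun p => phi (c :: p))); try assumption.
    + apply transfer_monotone_cons; assumption.
    + reflexivity.
    + rewrite S_INR in Hsum. simpl in Hsum. lra.
  - destruct (exists_opposite a c l Hac Hsum) as [z [Hz Hor]].
    apply in_split in Hz as [l1 [l2 ->]].
    apply Forall_app in Hl as [Hl1 Hl2]. inversion Hl2 as [|? ? Hz1 Hl2']; subst.
    assert (Forall in01 (l1 ++ l2)) by (apply Forall_app; auto).
    rewrite (proj1 Hphi _ (a :: z :: l1 ++ l2)).
    2:{ constructor. symmetry. apply Permutation_middle. }
    apply Rle_trans with (phi (c :: (a + z - c) :: l1 ++ l2)).
    + destruct Hor as [Hor|Hor].
      * apply (proj2 Hphi); try assumption; lra.
      * rewrite (proj1 Hphi _ (z :: a :: l1 ++ l2)) by constructor.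
        apply (proj2 Hphi); try assumption; lra.
    + apply (IH (fun p => phi (c :: p))).
      * apply transfer_monotone_cons; [|exact Hphi]. unfold in01 in *. lra.
      * rewrite length_app. simpl. rewrite length_app. lia.
      * constructor; [|assumption]. unfold in01 in *. lra.
      * rewrite S_INR in Hsum. simpl in Hsum. rewrite sumR_app in Hsum. simpl in *.
        rewrite sumR_app. lra.
Qed.

(** * Schur-concavity of the rate and homogeneous thresholds *)

Lemma rate_transfer_monotone (rho : R) :
  0 < rho -> rho <= 1 -> transfer_monotone (rate rho).
Proof.
  intros H0 H1. split.
  - intros p q H. apply rate_perm. exact H.
  - intros. apply rate_transfer; assumption.
Qed.

Lemma sumR_repeat (c : R) (n : nat) : sumR (repeat c n) = INR n * c.
Proof.
  induction n as [|n IH]; [simpl; ring|]. rewrite S_INR. cbn [repeat].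
  unfold sumR in *. simpl. lra.
Qed.

Theorem theorem2 (rho : R) (n : nat) (Hrho : 0 < rho) (Hrho1 : rho <= 1)
  (Hn : (2 <= n)%nat) :
  (* Schur-concavity of R(p) on [0,1]^n *)
  (forall p q : list R, length p = n -> length q = n ->
     Forall in01 p -> Forall in01 q -> majorizes p q ->
     sumrate_p rho p <= sumrate_p rho q) /\
  (* a homogeneous threshold policy solves the threshold selection problem *)
  (forall lam : R, 0 < lam <= INR n ->
   forall tau : list (option R), length tau = n -> Forall valid_thr tau ->
     sumR (map (fbprob rho) tau) <= lam ->
     exists t : option R, valid_thr t /\
       sumR (map (fbprob rho) (repeat t n)) <= lam /\
       sumrate rho tau <= sumrate rho (repeat t n)).
Proof.
  pose proof (rate_transfer_monotone rho Hrho Hrho1) as Hphi.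
  split.
  - intros p q _ _ Hp Hq Hmaj. rewrite !sumrate_p_rate by assumption.
    apply majorizes_le; assumption.
  - intros lam _ tau Hlen Htau Hlam.
    set (p := map (fbprob rho) tau) in *.
    assert (Forall in01 p) as Hp.
    { apply Forall_map. eapply Forall_impl; [|exact Htau]. apply fbprob_in01, Hrho. }
    assert (length p = n) as Lp by (unfold p; rewrite length_map; exact Hlen).
    assert (0 < INR n) as Hn0 by (apply lt_0_INR; lia).
    (* The common feedback probability is the mean, so the homogeneous policy has the same total
       feedback as [tau]. *)
    set (c := sumR p / INR n).
    assert (sumR p = INR n * c) as Hc by (unfold c; field; lra).
    assert (in01 c) as Hc01.
    { pose proof (sumR_ge 0 p) as Hge. pose proof (sumR_le 1 p) as Hle.
      rewrite Lp in Hge, Hle.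
      specialize (Hge ltac:(eapply Forall_impl; [|exact Hp]; unfold in01; simpl; intros; lra)).
      specialize (Hle ltac:(eapply Forall_impl; [|exact Hp]; unfold in01; simpl; intros; lra)).
      split; apply Rmult_le_reg_l with (INR n); lra. }
    destruct (Finv_correct rho Hrho c Hc01) as [Hv Hf].
    exists (Finv rho (1 - c)).
    rewrite map_repeat, Hf, sumR_repeat.
    split; [exact Hv|]. split; [lra|].
    rewrite !sumrate_rate; try assumption.
    + rewrite map_repeat, Hf. apply mean_le; assumption.
    + apply Forall_forall. intros t Ht. apply repeat_spec in Ht as ->. exact Hv.
Qed.
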